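(* Let $n$ be a prime with $n>17$. Then the graph $C_n$ on $Z_n$ generated by the two maps $T(x)=2x$ and $S(x)=3x+1$ has exactly $4$ triangles.
   Context: $Z_n=\mathbb{Z}/n\mathbb{Z}$. The graph on $Z_n$ generated by maps $T,S:Z_n\to Z_n$ is the finite simple undirected graph with vertex set $Z_n$ in which two distinct points $x,y$ are joined by an edge if and only if at least one of $T(x)=y$, $T(y)=x$, $S(x)=y$, $S(y)=x$ holds (directions, self-loops and multiple connections are disregarded). A triangle is a set of three pairwise adjacent distinct vertices. *)

(* Defs.v *)
From mathcomp Require Import all_boot all_algebra.

Set Implicit Arguments.
Unset Strict Implicit.
Unset Printing Implicit Defensive.

Section GeneratedGraph.

Variable V : finType.

(* A finite simple graph on V is given by its adjacency relation. *)
Definition gen_graph (T S : V -> V) : rel V :=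
  fun x y => (x != y) && [|| T x == y, T y == x, S x == y | S y == x].

Lemma gen_graph_irr (T S : V -> V) : irreflexive (gen_graph T S).
Proof. by move=> x; rewrite /gen_graph eqxx. Qed.

Lemma gen_graph_sym (T S : V -> V) : symmetric (gen_graph T S).
Proof.
move=> x y; rewrite /gen_graph eq_sym; congr (_ && _).
by rewrite orbCA; congr (_ || (_ || _)); rewrite orbC.
Qed.

Definition is_triangle (e : rel V) (A : {set V}) : bool :=
  (#|A| == 3) && [forall x in A, forall y in A, (x != y) ==> e x y].

Definition triangles (e : rel V) : {set {set V}} :=
  [set A | is_triangle e A].

End GeneratedGraph.

(* 'Z_n is the ring of integers modulo n only for n > 1. *)
Definition C_graph (n : nat) : rel 'Z_n :=
  gen_graph (fun x : 'Z_n => 2%:R * x)%R (fun x : 'Z_n => 3%:R * x + 1)%R.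
Arguments C_graph n : clear implicits.

(* Main.v *)
Require Import Defs.
From mathcomp Require Import all_boot all_algebra.
From mathcomp Require Import ring.

Import GRing.Theory.

(** Direct every edge along the map that produces it: an arrow goes from [x] to
    [T x] and to [S x].  The three edges of a triangle, each with a direction,
    form a tournament on three points, which is either a directed cycle or
    transitive.  In both cases one linear equation pins the triangle down.

    - Directed cycle: a composite of three maps, each [T] or [S], fixes a
      vertex.  Up to rotation the composite is [TTT], [STT], [TSS] or [SSS].
      The first and the last only give the fixed point [0] of [T] and the fixed
      point [-1/2] of [S], hence no triangle ([cycle_TTT], [cycle_SSS]).  The
      other two give [{-1/11, -2/11, -4/11}] and [{-4/17, -8/17, -7/17}].
    - Transitive: the source [x] has two distinct out-neighbours, so these are
      [T x] and [S x], and there is an arrow between them.  From [T x] to [S x]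
      this gives [{1, 2, 4}]; from [S x] to [T x] it gives
      [{-4/7, -8/7, -5/7}] ([T_image_arrow], [S_image_arrow]).

    Every denominator above, every coefficient that has to be cancelled, and
    almost every difference that has to be nonzero is a product of primes at
    most [17], so the argument takes place in a finite field whose
    characteristic exceeds [17].  The only exception is telling the triangles
    over [17] and over [7] apart: in characteristics [19] and [29] they share
    vertices, but they are never equal ([uniq_four_triangles]).

    The fractions [a / b] are manipulated through their integer numerator and
    denominator, so that each nonvanishing condition becomes the computation
    of the prime factors of a concrete number. *)

Local Notation tri x y z := [set x; y; z].

(** * Triangles as three-point sets *)

Section Triples.

Set Implicit Arguments.
Unset Strict Implicit.

Variable V : finType.
Implicit Types (x y z : V) (A : {set V}).

Lemma tri_rot x y z : tri y z x = tri x y z.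
Proof. by apply/setP => u; rewrite !inE orbC orbA. Qed.

Lemma tri_swap x y z : tri y x z = tri x y z.
Proof. by apply/setP => u; rewrite !inE (orbC (u == y)). Qed.

Lemma triangleP (e : rel V) A :
    irreflexive e -> symmetric e ->
  reflect (exists x y z, [/\ e x y, e y z, e x z & A = tri x y z])
          (is_triangle e A).
Proof.
move=> e_irr e_sym; have e_neq x y : e x y -> x != y.
  by apply: contraTneq => ->; rewrite e_irr.
apply: (iffP andP) => [[A3 /forall_inP eA]|[x [y [z [exy eyz exz ->]]]]].
  have : size (enum A) = 3 by rewrite -cardE; apply/eqP.
  have := enum_uniq A; have := mem_enum A.
  case: (enum A) => [|x [|y [|z []]]] //= memA uA _.
  have {memA} defA : A = tri x y z.
    by apply/setP => u; rewrite -memA !inE orbA.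
  have eA2 u v : u \in A -> v \in A -> u != v -> e u v.
    by move=> Au Av; apply/implyP; move/forall_inP: (eA u Au); apply.
  move: uA; rewrite !inE negb_or andbT => /andP[/andP[nxy nxz] nyz].
  by exists x, y, z; split=> //; apply: eA2; rewrite // defA !inE eqxx ?orbT.
split.
  by rewrite -setUA cardsU1 !inE negb_or cards2 !e_neq.
apply/forall_inP => u Au; apply/forall_inP => v Av; apply/implyP.
move: Au Av; rewrite !inE -!orbA => /or3P[]/eqP-> /or3P[]/eqP->;
  by [rewrite eqxx | move=> _ | move=> _; rewrite e_sym].
Qed.

End Triples.

(** * Fractions with small prime factors *)

Section LargeCharacteristic.

Set Implicit Arguments.
Unset Strict Implicit.

Local Open Scope ring_scope.

Variable F : finFieldType.
Hypothesis pchar_gt17 : forall p, p \in [pchar F] -> (17 < p)%N.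

Definition mapT (x : F) := 2%:R * x.
Definition mapS (x : F) := 3%:R * x + 1.

(* The predicate computes on numerals: side conditions reduce to [true]. *)
Local Notation smooth17 k := ([pred p | (p <= 17)%N].-nat k).

Lemma smooth_natr_neq0 k : smooth17 k -> k%:R != 0 :> F.
Proof.
move=> k_smooth; have kpos : (0 < k)%N by case/andP: k_smooth.
apply/negP => k0; have [p p_char] := natf0_pchar kpos k0.
have p_pr := pcharf_prime p_char.
have p_dvd : (p %| k)%N by rewrite (dvdn_pcharf p_char).
move/(pnatP _ kpos): k_smooth => /(_ p p_pr p_dvd).
by rewrite inE leqNgt pchar_gt17.
Qed.

Definition frac (a : int) (b : nat) : F := a%:~R / b%:R.

Lemma frac_eqE a b c d : smooth17 b -> smooth17 d ->
  (frac a b == frac c d) = ((a * d%:Z - c * b%:Z)%:~R == 0 :> F).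
Proof.
move=> /smooth_natr_neq0 b0 /smooth_natr_neq0 d0.
by rewrite /frac eqr_div // rmorphB !rmorphM /= subr_eq0.
Qed.

Lemma frac_neq (a : int) b (c : int) d : smooth17 b -> smooth17 d ->
  smooth17 (absz (a * d%:Z - c * b%:Z)%R) -> frac a b != frac c d.
Proof.
move=> b17 d17 /smooth_natr_neq0 num0; rewrite frac_eqE //.
apply: contra num0; case: (a * d%:Z - c * b%:Z) => m //=.
by rewrite NegzE rmorphN oppr_eq0.
Qed.

Lemma T_frac a b : mapT (frac a b) = frac (2%:Z * a) b.
Proof. by rewrite /mapT /frac rmorphM /= mulrA. Qed.

Lemma S_frac a b : smooth17 b -> mapS (frac a b) = frac (3%:Z * a + b) b.
Proof.
move=> /smooth_natr_neq0 b0.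
by rewrite /mapS /frac rmorphD rmorphM /= [RHS]mulrDl divff // mulrA.
Qed.

Lemma eq_frac x a b : smooth17 b -> b%:R * x = a%:~R -> x = frac a b.
Proof.
by move=> /smooth_natr_neq0 b0 e; rewrite /frac -e mulrAC divff ?mul1r.
Qed.

(** * The four triangles *)

Definition fractri b a1 a2 a3 := tri (frac a1 b) (frac a2 b) (frac a3 b).

Definition four_triangles : seq {set F} :=
  [:: fractri 1 1 2 4; fractri 11 (-4) (-1) (-2);
      fractri 17 (-4) (-8) (-7); fractri 7 (-4) (-8) (-5)].

Definition arrow (x y : F) := (mapT x == y) || (mapS x == y).

Lemma cycle_STT x y z : mapS x = y -> mapT y = z -> mapT z = x ->
  tri x y z = fractri 11 (-4) (-1) (-2).
Proof.
move=> <- <- e; have -> : x = frac (-4) 11.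
  apply: eq_frac => //; apply/(addIr x)/esym.
  by rewrite -[in LHS]e /mapS /mapT; ring.
by rewrite S_frac // !T_frac.
Qed.

Lemma cycle_TSS x y z : mapT x = y -> mapS y = z -> mapS z = x ->
  tri x y z = fractri 17 (-4) (-8) (-7).
Proof.
move=> <- <- e; have -> : x = frac (-4) 17.
  apply: eq_frac => //; apply/(addIr x)/esym.
  by rewrite -[in LHS]e /mapS /mapT; ring.
by rewrite !T_frac S_frac.
Qed.

Lemma cycle_TTT x y z : mapT x = y -> mapT y = z -> mapT z = x -> x = y.
Proof.
move=> <- <- e; have -> : x = frac 0 7.
  apply: eq_frac => //; apply/(addIr x).
  by rewrite -[in RHS]e /mapT; ring.
by rewrite T_frac mulr0.
Qed.

Lemma cycle_SSS x y z : mapS x = y -> mapS y = z -> mapS z = x -> x = y.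
Proof.
move=> <- <- e; have -> : x = frac (-13) 26.
  apply: eq_frac => //; apply/(addIr x).
  by rewrite -[in RHS]e /mapS; ring.
by rewrite S_frac.
Qed.

(** The eight words in the two maps fall into four classes under rotation of
    the cycle, which leaves the set of vertices unchanged. *)
Lemma cyclic_triangle x y z : x != y -> arrow x y -> arrow y z -> arrow z x ->
  tri x y z \in four_triangles.
Proof.
rewrite !inE => /eqP nxy /orP[]/eqP xy /orP[]/eqP yz /orP[]/eqP zx.
- by case: nxy; apply: cycle_TTT zx.
- by rewrite -2!tri_rot (cycle_STT zx xy yz) eqxx orbT.
- by rewrite -tri_rot (cycle_STT yz zx xy) eqxx orbT.
- by rewrite (cycle_TSS xy yz zx) eqxx !orbT.
- by rewrite (cycle_STT xy yz zx) eqxx orbT.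
- by rewrite -tri_rot (cycle_TSS yz zx xy) eqxx !orbT.
- by rewrite -2!tri_rot (cycle_TSS zx xy yz) eqxx !orbT.
- by case: nxy; apply: cycle_SSS zx.
Qed.

(** The arrow is [4 x = 3 x + 1] or [6 x + 1 = 3 x + 1]; the latter forces [x]
    to be the fixed point of the doubling map. *)
Lemma T_image_arrow x : x != mapT x -> arrow (mapT x) (mapS x) ->
  tri x (mapT x) (mapS x) = fractri 1 1 2 4.
Proof.
move=> nx /orP[]/eqP e.
  have -> : x = frac 1 1.
    apply: eq_frac => //; apply/(addIr (mapS x)).
    by rewrite -[in RHS]e /mapS /mapT; ring.
  by rewrite T_frac S_frac.
case/eqP: nx; have -> : x = frac 0 3.
  apply: eq_frac => //; apply/(addIr (mapS x)).
  by rewrite -[in RHS]e /mapS /mapT; ring.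
by rewrite T_frac mulr0.
Qed.

(** The arrow is [6 x + 2 = 2 x] or [9 x + 4 = 2 x]; the former forces [x] to be
    the fixed point [-1/2] of the other map. *)
Lemma S_image_arrow x : x != mapS x -> arrow (mapS x) (mapT x) ->
  tri x (mapT x) (mapS x) = fractri 7 (-4) (-8) (-5).
Proof.
move=> nx /orP[]/eqP e.
  case/eqP: nx; have -> : x = frac (-2) 4.
    apply: eq_frac => //; apply/(addIr (mapT x)).
    by rewrite -[in RHS]e /mapS /mapT; ring.
  by rewrite S_frac.
have -> : x = frac (-4) 7.
  apply: eq_frac => //; apply/(addIr (mapT x)).
  by rewrite -[in RHS]e /mapS /mapT; ring.
by rewrite T_frac S_frac.
Qed.

(** Since [y] and [z] differ, the two arrows leaving [x] come from different
    maps. *)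
Lemma transitive_triangle x y z : x != y -> x != z -> y != z ->
  arrow x y -> arrow x z -> arrow y z -> tri x y z \in four_triangles.
Proof.
rewrite !inE => nxy nxz nyz /orP[]/eqP ey /orP[]/eqP ez ayz; subst y z.
- by rewrite eqxx in nyz.
- by rewrite T_image_arrow ?eqxx.
- by rewrite -tri_rot tri_swap tri_rot S_image_arrow ?eqxx ?orbT.
- by rewrite eqxx in nyz.
Qed.

Lemma gen_graphE x y :
  gen_graph mapT mapS x y = (x != y) && (arrow x y || arrow y x).
Proof.
rewrite /gen_graph /arrow; congr (_ && _).
by do 4!case: (_ == _).
Qed.

Lemma four_trianglesP A :
  is_triangle (gen_graph mapT mapS) A = (A \in four_triangles).
Proof.
have gsym := gen_graph_sym mapT mapS; have girr := gen_graph_irr mapT mapS.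
apply/(triangleP A girr gsym)/idP => [[x [y [z []]]]|].
  rewrite !gen_graphE => /andP[nxy axy] /andP[nyz ayz] /andP[nxz axz] ->.
  have [nyx nzy nzx] : [/\ y != x, z != y & z != x].
    by rewrite eq_sym nxy eq_sym nyz eq_sym nxz.
  (* Six of the eight tournaments are transitive; list the source first, the
     sink last. *)
  case/orP: axy => axy; case/orP: ayz => ayz; case/orP: axz => axz.
  - exact: transitive_triangle.
  - exact: cyclic_triangle.
  - by rewrite -tri_rot tri_swap tri_rot; apply: transitive_triangle.
  - by rewrite -2!tri_rot; apply: transitive_triangle.
  - by rewrite -tri_swap; apply: transitive_triangle.
  - by rewrite -tri_rot; apply: transitive_triangle.
  - by rewrite -tri_swap; apply: cyclic_triangle.
  - by rewrite -tri_rot tri_swap; apply: transitive_triangle.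
have fractri_edges b a1 a2 a3 :
    gen_graph mapT mapS (frac a1 b) (frac a2 b) ->
    gen_graph mapT mapS (frac a2 b) (frac a3 b) ->
    gen_graph mapT mapS (frac a1 b) (frac a3 b) ->
  exists x y z, [/\ gen_graph mapT mapS x y, gen_graph mapT mapS y z,
                      gen_graph mapT mapS x z
                    & fractri b a1 a2 a3 = tri x y z].
  by exists (frac a1 b), (frac a2 b), (frac a3 b).
by rewrite !inE => /or4P[]/eqP->; apply: fractri_edges;
  rewrite gen_graphE frac_neq //= /arrow !T_frac !S_frac // !eqxx ?orbT.
Qed.

(** Apart from the last pair, the first vertex of each triangle avoids all later
    triangles, because its differences from their vertices have numerators
    composed of primes at most [17]; this is why [-4/11] is listed first. *)
Lemma uniq_four_triangles : uniq four_triangles.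
Proof.
have neq_first b a1 a2 a3 d c1 c2 c3 :
    frac a1 b != frac c1 d -> frac a1 b != frac c2 d ->
    frac a1 b != frac c3 d -> fractri b a1 a2 a3 != fractri d c1 c2 c3.
  move=> n1 n2 n3; apply/eqP => /setP/(_ (frac a1 b)).
  by rewrite !inE eqxx (negbTE n1) (negbTE n2) (negbTE n3).
(* If the last two triangles agree, then [-4/17] lies in the last one, where it
   can only be [-5/7], so [57 = 0]; likewise for [-8/17], so [29 = 0]. *)
have neq34 : fractri 17 (-4) (-8) (-7) != fractri 7 (-4) (-8) (-5).
  apply/eqP => /setP e34.
  have /esym := e34 (frac (-4) 17); rewrite !inE eqxx.
  rewrite [_ == frac (-4) 7](negbTE (frac_neq _ _ _)) //.
  rewrite [_ == frac (-8) 7](negbTE (frac_neq _ _ _)) //=.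
  rewrite frac_eqE // => /eqP z57.
  have /esym := e34 (frac (-8) 17); rewrite !inE eqxx orbT.
  rewrite [_ == frac (-4) 7](negbTE (frac_neq _ _ _)) //.
  rewrite [_ == frac (-8) 7](negbTE (frac_neq _ _ _)) //=.
  rewrite frac_eqE // => /eqP z29.
  have /eqP[] := oner_neq0 F.
  have -> : 1 = 2%:R * (-8 * 7 - -5 * 17 : int)%:~R
                - (-4 * 7 - -5 * 17 : int)%:~R :> F by ring.
  by rewrite z29 z57 mulr0 subrr.
rewrite /= !inE !negb_or neq34 !andbT -!andbA.
by apply/and5P; split; apply: neq_first; apply: frac_neq.
Qed.

Lemma card_triangles : #|triangles (gen_graph mapT mapS)| = 4%N.
Proof.
rewrite -[RHS]/(size four_triangles) -(card_uniqP uniq_four_triangles).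
by apply: eq_card => A; rewrite inE four_trianglesP.
Qed.

End LargeCharacteristic.

Theorem proposition5 (n : nat) (hn : prime n) (hn17 : 17 < n) :
  #|triangles (C_graph n)| = 4.
Proof.
have large p : p \in [pchar 'F_n]%R -> 17 < p.
  by rewrite (pcharf_eq (pchar_Fp hn)) inE => /eqP ->.
(* ['F_n] is ['Z_(pdiv n)], and this is the type with the field structure. *)
rewrite -(pdiv_id hn); exact: (card_triangles large).
Qed.
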